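(* Let $n\ge 3$ and let $C_n$ be the $n$-cycle graph. Then $\mu(C_n)=4$, and in particular the ideal $I_{C_n}$ is generated by its elements of degrees $2$ and $4$.
   Context: Graphs are finite and simple. For a graph $G$ with vertex set $[n]=\{1,\dots,n\}$, edge set $E(G)$ and set of isolated vertices $Iso(G)$, the ideal of the binary graph model (graph ideal) $I_G$ is the kernel of the $\mathbb{C}$-algebra homomorphism $$\phi_G:\mathbb{C}[p_{i_1\cdots i_n}\mid i_j\in\{0,1\}]\to \mathbb{C}[t^{(j,k)}_{a,b},\,t^{(l)}_{a}\mid \{j,k\}\in E(G),\ l\in Iso(G),\ a,b\in\{0,1\}],$$ $$p_{i_1\cdots i_n}\mapsto \prod_{\{j,k\}\in E(G)}t^{(j,k)}_{i_j,i_k}\prod_{l\in Iso(G)}t^{(l)}_{i_l}.$$ It is a toric ideal, homogeneous in the standard grading. The Markov width $\mu(G)$ is the largest degree of a minimal generator of $I_G$, i.e. the largest degree of an element of a minimal homogeneous generating set of $I_G$. The $n$-cycle $C_n$ has vertices $1,\dots,n$ and edges $\{1,2\},\{2,3\},\dots,\{n-1,n\},\{n,1\}$. *)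

(* Defs.v *)
From HB Require Import structures.
From mathcomp Require Import all_boot all_order all_algebra.
From mathcomp Require Import mpoly complex.
From mathcomp Require Import classical_sets reals.

Set Implicit Arguments.
Unset Strict Implicit.
Unset Printing Implicit Defensive.

Import GRing.Theory.
Local Open Scope classical_set_scope.
Local Open Scope ring_scope.

Record sgraph (n : nat) := SGraph {
  adj : rel 'I_n;
  adj_sym : ssrbool.symmetric adj;
  adj_irrefl : irreflexive adj
}.

Section GraphIdeal.
Context (K : fieldType) (n : nat) (G : sgraph n).

(* The edge {j, k} is represented by the pair (j, k) with j < k. *)
Definition is_edge (e : 'I_n * 'I_n) : bool :=
  adj G e.1 e.2 && (e.1 < e.2)%N.

Definition is_isolated (v : 'I_n) : bool := [forall w, ~~ adj G v w].

Definition edge : finType := {e : 'I_n * 'I_n | is_edge e}.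
Definition isolated : finType := {v : 'I_n | is_isolated v}.

(* 0/1 words i_1 ... i_n, with 0 = false and 1 = true. *)
Definition state : finType := {ffun 'I_n -> bool}.

(* inl (e, (a, b)) is the index of t^(e)_{a,b}; inr (l, a) that of t^(l)_a. *)
Definition param : finType := (edge * (bool * bool) + isolated * bool)%type.

(* K[p_i] and K[t]: variables are numbered by ordinals, through the
   enumeration of the type of their indices. *)
Local Notation prob_ring := {mpoly K[#|state|]}.
Local Notation param_ring := {mpoly K[#|param|]}.

Definition tvar (u : param) : param_ring := 'X_(enum_rank u).

Definition param_monomial (x : state) : param_ring :=
  \prod_(e : edge) tvar (inl (e, (x (val e).1, x (val e).2)))
  * \prod_(l : isolated) tvar (inr (l, x (val l))).

Definition graph_morphism : prob_ring -> param_ring :=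
  mmap (@mpolyC #|param| K)
       (fun i : 'I_#|state| => param_monomial (enum_val i)).

Definition graph_ideal : set prob_ring := [set f | graph_morphism f = 0].

End GraphIdeal.

Arguments graph_ideal K [n] G _.

Section MarkovWidth.
Context (K : fieldType) (N : nat).
Implicit Types (I S T : set {mpoly K[N]}) (d : nat).

Definition ideal_span S : set {mpoly K[N]} :=
  [set f | exists (m : nat) (c g : 'I_m -> {mpoly K[N]}),
     (forall i, S (g i)) /\ f = \sum_(i < m) c i * g i].

Definition minimal_homog_generators I S : Prop :=
  [/\ forall f, S f -> exists d, f \is d.-homog,
      ideal_span S = I
    & forall T, T `<=` S -> ideal_span T = I -> T = S].

(* msize is the total degree plus one on nonzero polynomials. *)
Definition tdegree (f : {mpoly K[N]}) : nat := (msize f).-1.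

(* The Markov width as a relation: it includes the existence of a minimal
   homogeneous generating set and the independence of d from its choice. *)
Definition has_markov_width I d : Prop :=
  (exists S, minimal_homog_generators I S) /\
  (forall S, minimal_homog_generators I S ->
     (exists2 f, S f & tdegree f = d) /\
     (forall f, S f -> (tdegree f <= d)%N)).

Definition homog_part I d : set {mpoly K[N]} :=
  [set f | I f /\ f \is d.-homog].

End MarkovWidth.

Section Cycle.
Context (n : nat).

(* Vertices are 0, ..., n-1; the clause i != j only matters for n = 1. *)
Definition cycle_adj : rel 'I_n := fun i j =>
  (i != j) && ((i.+1 %% n == j :> nat)%N || (j.+1 %% n == i :> nat)%N).

Lemma cycle_adj_sym : ssrbool.symmetric cycle_adj.
Proof. by move=> i j; rewrite /cycle_adj eq_sym orbC. Qed.

Lemma cycle_adj_irrefl : irreflexive cycle_adj.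
Proof. by move=> i; rewrite /cycle_adj eqxx. Qed.

Definition cycle_graph : sgraph n := SGraph cycle_adj_sym cycle_adj_irrefl.

End Cycle.

(* Main.v *)
From HB Require Import structures.
Require Import Defs.
From mathcomp Require Import all_boot all_order all_algebra.
From mathcomp Require Import fingroup perm mpoly complex.
From mathcomp Require Import boolp classical_sets reals.
From mathcomp Require Import zify.

(** A monomial is a table whose rows are 0/1 words around the cycle, and two
    monomials have the same image iff their tables have the same marginals on
    all the edges; the ideal is spanned by the corresponding binomials
    ([ideal_of_binomials]).  Two rows which agree at two vertices may exchange one
    of the arcs between them: this is a quadratic move.  Triangulate the cycle by
    the chords from vertex 0 and let two tables of a fiber agree on the vertices
    0, ..., k.  Among the rows, let t count those that read 1,1 at the vertices 0
    and k+1.  If t is larger for the first table, then t can be lowered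
    in it by arc exchanges which do not touch the vertices 0, ..., k
    ([chord_decrease]).  Since the roles of the tables are symmetric, only lowering
    is needed, and the marginals of the chord {0,k+1} can be made equal.  The counts
    on the triangle 0, k, k+1 are then two 2 x 2 x 2 tables with the same edge
    marginals; they differ by a multiple of the parity function, and a move of
    degree 4 reduces this multiple ([triangle_decrease]).  When it is zero, arc
    exchanges make the tables agree at k+1 too ([align_next]).  This yields
    [conn_same_fiber], and the generation of the ideal in degrees 2 and 4
    ([cycle_ideal_generated]).

    For the lower bound, extend the words on the triangle to the cycle by repeating
    the third letter.  The product of the four words of odd parity minus that of
    the four words of even parity is in the ideal.  A proper divisor of one of
    these products is alone in its fiber, so it occurs in no element of the ideal
    ([low_degree_coeff]); hence the quartic is not generated in degrees below 4.

    Finally, when an ideal is generated by finitely many homogeneous elements of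
    degree at most d, a minimal homogeneous generating set exists, and a generator
    of degree greater than d is redundant in any of them
    ([markov_width_intro]). *)

Set Implicit Arguments.
Unset Strict Implicit.
Unset Printing Implicit Defensive.

(** * Tables of words and their edge marginals *)

Section Tables.
Variables (I : finType) (n : nat).
Implicit Types (u v : I -> nat -> bool) (r s q : I) (i k : nat).

Definition nb_rows (P : I -> bool) : nat := \sum_r P r.

Lemma nb_rows_eq (P Q : I -> bool) : P =1 Q -> nb_rows P = nb_rows Q.
Proof. by move=> e; apply: eq_bigr => r _; rewrite e. Qed.

Lemma nb_rows_add (P Q S : I -> bool) :
  (forall r, P r = Q r + S r :> nat) -> nb_rows P = nb_rows Q + nb_rows S.
Proof. by move=> e; rewrite /nb_rows -big_split; apply: eq_bigr => r _; rewrite e. Qed.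

Lemma nb_rows_lt (P Q : I -> bool) r :
  (forall q, P q -> Q q) -> Q r -> ~~ P r -> nb_rows P < nb_rows Q.
Proof.
move=> PQ Qr nPr; rewrite /nb_rows (bigD1 r) //= [ltnRHS](bigD1 r) //= Qr (negPf nPr).
rewrite add0n add1n ltnS; apply: leq_sum => q _.
by have := PQ q; case: (P q) => // ->.
Qed.

Lemma nb_rows_eq0 (P : I -> bool) r : nb_rows P = 0 -> P r = false.
Proof. by rewrite /nb_rows (bigD1 r) //=; case: (P r). Qed.

Lemma nb_rows_gt0 (P : I -> bool) : 0 < nb_rows P -> exists r, P r.
Proof.
move=> gt0; apply/existsP; apply: contraLR gt0 => /existsPn nP.
by rewrite -leqNgt leqn0 /nb_rows big1 // => r _; rewrite (negPf (nP r)).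
Qed.

Definition edge_count u i a b := nb_rows (fun r => (u r i == a) && (u r i.+1 == b)).

(** Column [n] repeats column [0]; the edge joining the vertices [n.-1] and [0]
    is then the pair of consecutive columns [n.-1], [n], and the cycle can be
    treated as a path with identified ends. *)
Definition closed_rows u := forall r, u r n = u r 0.

Definition same_marginals u v :=
  forall i a b, i < n -> edge_count u i a b = edge_count v i a b.

(** Grouping the rows according to their values at [i] and [i.+1] turns any
    iterated operation on these two columns into a function of the edge
    marginal. *)
Lemma big_edge (T : Type) (idx : T) (op : Monoid.com_law idx) u v i
    (F : bool -> bool -> T) :
  (forall a b, edge_count u i a b = edge_count v i a b) ->
  \big[op/idx]_r F (u r i) (u r i.+1) = \big[op/idx]_r F (v r i) (v r i.+1).
Proof.
suff part w : \big[op/idx]_r F (w r i) (w r i.+1)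
    = \big[op/idx]_(ab : bool * bool)
        iter (edge_count w i ab.1 ab.2) (op (F ab.1 ab.2)) idx.
  by move=> e; rewrite !part; apply: eq_bigr => ab _; rewrite e.
rewrite (partition_big (fun r => (w r i, w r i.+1)) predT) //=.
apply: eq_bigr => -[a b] _ /=.
rewrite (eq_bigr (fun=> F a b)) => [|r /eqP [-> ->] //].
rewrite big_const; congr (iter _ _ _).
rewrite -sum1_card big_mkcond; apply: eq_bigr => r _.
by rewrite -topredE /=; case: (_ && _).
Qed.

Lemma nb_rows_edge u v i (F : bool -> bool -> bool) :
  (forall a b, edge_count u i a b = edge_count v i a b) ->
  nb_rows (fun r => F (u r i) (u r i.+1)) = nb_rows (fun r => F (v r i) (v r i.+1)).
Proof. exact: (@big_edge _ _ _ u v i (fun a b => nat_of_bool (F a b))). Qed.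

Lemma same_marginals_perm u v :
  (forall i, i < n -> exists p : {perm I},
     forall r, v r i = u (p r) i /\ v r i.+1 = u (p r) i.+1) ->
  same_marginals u v.
Proof.
move=> h i a b /h [p hp].
rewrite /edge_count /nb_rows (reindex_inj (@perm_inj _ p)) /=.
by apply: eq_bigr => r _; have [-> ->] := hp r.
Qed.

(** Two tables are connected when their monomials are congruent modulo the
    binomials of degree 2 and 4 of the ideal: a move alters two or four rows and
    keeps the edge marginals.  The order of the rows is kept as well, so
    reordering rows counts as a move. *)
Inductive conn : (I -> nat -> bool) -> (I -> nat -> bool) -> Prop :=
| ConnMove (A : {set I}) u v : #|A| \in [:: 2; 4] ->
    closed_rows u -> closed_rows v -> same_marginals u v ->
    (forall r i, r \notin A -> u r i = v r i) -> conn u v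
| ConnRefl u v : closed_rows u ->
    (forall r i, i <= n -> u r i = v r i) -> conn u v
| ConnSym u v : conn u v -> conn v u
| ConnTrans v u w : conn u v -> conn v w -> conn u w.

Definition same_fiber u v :=
  [/\ closed_rows u, closed_rows v & same_marginals u v].

Lemma same_fiber_sym u v : same_fiber u v -> same_fiber v u.
Proof. by case=> cu cv m; split=> // i a b lt_i; rewrite m. Qed.

Lemma same_fiber_trans v u w : same_fiber u v -> same_fiber v w -> same_fiber u w.
Proof. by case=> cu _ m [_ cw m']; split=> // i a b lt_i; rewrite m ?m'. Qed.

Lemma conn_fiber u v : conn u v -> same_fiber u v.
Proof.
elim=> {u v} [A u v _ cu cv muv _|u v cu e|u v _ h|v u w _ h1 _ h2].
- by [].
- split=> // [r|i a b lt_in]; first by rewrite -!e.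
  by apply: nb_rows_eq => r; rewrite !e // ltnW.
- exact: same_fiber_sym.
- exact: same_fiber_trans h1 h2.
Qed.


Definition permute_cols (D : nat -> bool) (p : I -> I) u : I -> nat -> bool :=
  fun r i => if D i then u (p r) i else u r i.

(** Inside the set of columns [D], and outside it, each pair of consecutive
    columns is permuted as a whole.  On the boundary, one of the two columns
    does not notice the permutation, so that the pair is either permuted as a
    whole or left alone. *)
Lemma permute_cols_marginals D (p : {perm I}) u :
  (forall i, i < n -> [\/ D i = D i.+1, forall r, u (p r) i = u r i
                        | forall r, u (p r) i.+1 = u r i.+1]) ->
  same_marginals u (permute_cols D p u).
Proof.
move=> h; apply: same_marginals_perm => i /h hi; rewrite /permute_cols.
case Di: (D i) hi; case Di1: (D i.+1) => hi.
- by exists p.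
- case: hi => // e; first by exists 1%g => r; rewrite perm1 e.
  by exists p => r; rewrite e.
- case: hi => // e; first by exists p => r; rewrite e.
  by exists 1%g => r; rewrite perm1 e.
- by exists 1%g => r; rewrite perm1.
Qed.

Lemma tperm_agree u r s i : u r i = u s i -> forall q, u (tperm r s q) i = u q i.
Proof. by move=> e q; case: tpermP => [->|->|//]. Qed.

Lemma conn_swap D u r s : closed_rows u -> r != s -> D 0 = D n ->
  (forall i, i < n -> [\/ D i = D i.+1, u r i = u s i | u r i.+1 = u s i.+1]) ->
  conn u (permute_cols D (tperm r s) u).
Proof.
move=> cu rs D0n h.
apply: (@ConnMove [set r; s]) => //; first by rewrite cards2 rs.
- by move=> q; rewrite /permute_cols D0n; case: ifP; rewrite cu.
- apply: permute_cols_marginals => i /h [e|/tperm_agree e|/tperm_agree e].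
  + exact: Or31.
  + exact: Or32.
  + exact: Or33.
move=> q i; rewrite !inE negb_or => /andP [qr qs].
by rewrite /permute_cols tpermD 1?eq_sym // if_same.
Qed.

(** The basic quadratic move: rows which agree in columns [a] and [b] may
    exchange their values strictly between [a] and [b]. *)
Definition swap_arc a b r s u :=
  permute_cols (fun i => a < i < b) (tperm r s) u.

Lemma conn_swap_arc a b u r s : closed_rows u -> r != s -> b <= n ->
  u r a = u s a -> u r b = u s b -> conn u (swap_arc a b r s u).
Proof.
move=> cu rs bn ea eb; apply: conn_swap => // [|i lt_in].
  by rewrite /= [n < b]ltnNge bn andbF.
have [->|na] := eqVneq i a; first exact: Or32.
have [->|nb] := eqVneq i.+1 b; first exact: Or33.
by apply: Or31; lia.
Qed.

Lemma swap_arcE a b r s u q i : ~~ (a < i < b) -> swap_arc a b r s u q i = u q i.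
Proof. by rewrite /swap_arc /permute_cols => /negPf ->. Qed.

Lemma swap_arcL a b r s u i : a < i < b -> swap_arc a b r s u r i = u s i.
Proof. by rewrite /swap_arc /permute_cols => ->; rewrite tpermL. Qed.

Lemma swap_arcD a b r s u q i : q != r -> q != s -> swap_arc a b r s u q i = u q i.
Proof. by move=> qr qs; rewrite /swap_arc /permute_cols tpermD 1?eq_sym // if_same. Qed.

Definition agree k u v := forall r i, i <= k -> u r i = v r i.

Lemma agree_swap_arc k a b r s u : k <= a -> agree k u (swap_arc a b r s u).
Proof. by move=> ka q i ik; rewrite swap_arcE //; lia. Qed.

Lemma agree_sym k u v : agree k u v -> agree k v u.
Proof. by move=> h r i le; rewrite h. Qed.

Lemma agree_trans k v u w : agree k u v -> agree k v w -> agree k u w.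
Proof. by move=> h h' r i le; rewrite h // h'. Qed.

(** The vertices [0], [k], [k.+1] span a triangle of the fan triangulation of
    the cycle with apex [0]; the marginals of a triangle and of a chord are not
    part of the data of the fiber. *)
Definition triangle u k a b c :=
  nb_rows (fun r => [&& u r 0 == a, u r k == b & u r k.+1 == c]).

Definition chord u k := nb_rows (fun r => u r 0 && u r k).

Lemma chord_triangle u k :
  chord u k.+1 = triangle u k true false true + triangle u k true true true.
Proof.
by apply: nb_rows_add => r; case: (u r 0); case: (u r k); case: (u r k.+1).
Qed.

(** If two tables of a fiber agree up to column [k], two of the three edge
    marginals of the triangle agree; this lemma and the next one record them. *)
Lemma triangle_prefix u v k a b : agree k u v ->
  triangle u k a b false + triangle u k a b true =
  triangle v k a b false + triangle v k a b true.
Proof.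
move=> uv.
suff h w : triangle w k a b false + triangle w k a b true
    = nb_rows (fun r => (w r 0 == a) && (w r k == b)).
  by rewrite !h; apply: nb_rows_eq => r; rewrite !uv.
apply/esym/nb_rows_add => r.
by case: (w r 0 == a); case: (w r k == b); case: (w r k.+1).
Qed.

Lemma triangle_edge u v k b c : same_marginals u v -> k < n ->
  triangle u k false b c + triangle u k true b c =
  triangle v k false b c + triangle v k true b c.
Proof.
move=> uv lt_kn.
suff h w : triangle w k false b c + triangle w k true b c = edge_count w k b c.
  by rewrite !h uv.
apply/esym/nb_rows_add => r.
by case: (w r 0); case: (w r k == b); case: (w r k.+1 == c).
Qed.

(** The number of edges of a path at which a 0/1 labelling changes; it has the
    parity of the change between the two ends, and it is minimal exactly when
    the labelling switches at most once. *)
Definition changes (f : nat -> bool) a b := \sum_(a <= j < b) (f j != f j.+1).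

Lemma changes_ge f a b : a <= b -> (f a != f b) <= changes f a b.
Proof.
elim: b => [|b IH]; first by rewrite leqn0 => /eqP ->; rewrite eqxx.
rewrite leq_eqVlt => /predU1P [->|]; first by rewrite eqxx.
rewrite ltnS => ab; rewrite /changes big_nat_recr //=.
have := IH ab; rewrite -/(changes f a b).
by case: (f a); case: (f b); case: (f b.+1) => //=; lia.
Qed.

(** A second switch would produce a value different from [f a] enclosed between
    [a] and a later return to [f a]. *)
Lemma changes_eq f a b : a <= b ->
  (forall d e, a < d < e -> e <= b -> f a = f e -> f d = f e) ->
  changes f a b = (f a != f b).
Proof.
move=> ab h; apply/eqP; rewrite eqn_leq changes_ge // andbT.
elim: b ab h => [|b IH].
  by rewrite leqn0 => /eqP -> _; rewrite /changes big_geq.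
rewrite leq_eqVlt => /predU1P [<- _|]; first by rewrite /changes big_geq.
rewrite ltnS => ab h; rewrite /changes big_nat_recr //= -/(changes f a b).
have {}IH : changes f a b <= (f a != f b).
  by apply: IH => // d e /[dup] ? /h /[swap] le; apply; lia.
have [eab|ltab] := eqVneq a b.
  by rewrite eab /changes big_geq.
have {h} h : f a = f b.+1 -> f b = f b.+1 by apply: h; lia.
by move: IH h; case: (f a); case: (f b); case: (f b.+1) => //= IH h; rewrite ?h //; lia.
Qed.
End Tables.

(** * Lowering the marginal of a chord by quadratic moves *)

Section Chord.
Variables (I : finType) (n : nat).
Implicit Types (u v : I -> nat -> bool) (r s q : I) (i k : nat).

Lemma chord_agree k u v : agree k u v -> chord u k = chord v k.
Proof. by move=> uv; apply: nb_rows_eq => r; rewrite !uv. Qed.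

(** The rows [x] and [y] read 1,1 and 0,0 at the ends [0], [k.+1] of the chord.
    Exchanging their values between [k] and [i] makes them read 1,0 and 0,1. *)
Lemma chord_decrease_swap u k x y i : closed_rows n u -> k < i -> i <= n ->
    u x 0 -> ~~ u y 0 -> u x k.+1 -> ~~ u y k.+1 ->
    u x k = u y k -> u x i = u y i ->
  exists u', [/\ conn n u u', agree k u u' & chord u' k.+1 < chord u k.+1].
Proof.
move=> cu ki i_n x0 y0 x1 y1 exyk exyi.
have xy : x != y by apply: contraTneq x0 => ->.
have k1i : k < k.+1 < i.
  rewrite ltnSn /= ltn_neqAle ki andbT.
  by apply: contraTneq x1 => e; rewrite e exyi -e.
exists (swap_arc k i x y u); split.
- exact: conn_swap_arc.
- exact: agree_swap_arc.
apply: (@nb_rows_lt _ _ _ x) => [q||]; [|by rewrite x0 x1|]; last first.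
  by rewrite [swap_arc _ _ _ _ _ x k.+1]swap_arcL // (negPf y1) andbF.
have -> : swap_arc k i x y u q 0 = u q 0 by rewrite swap_arcE.
have [->|qx] := eqVneq q x; first by rewrite x0 x1.
have [->|qy] := eqVneq q y; first by rewrite (negPf y0).
by rewrite swap_arcD.
Qed.

(** The chord from [0] to [k.+1] separates a triangle from the path
    [k.+1], ..., [n].  Its marginal can be lowered if neither side forbids it:
    the triangle does not, by the existence of the rows [x] and [y] below.  If
    all the exchanges on the path side are impossible, then relatively to [x]
    every row switches at most once along the path.  So [u] has the smallest
    number of switches compatible with its values at the two ends of the path;
    this total number is a function of the edge marginals, hence is the same
    for [v], and [v] cannot have fewer rows that read 1,1 on the chord. *)
Lemma chord_decrease u v k : same_fiber n u v -> agree k u v -> k.+1 < n ->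
    chord v k.+1 < chord u k.+1 ->
  exists u', [/\ conn n u u', agree k u u' & chord u' k.+1 < chord u k.+1].
Proof.
move=> [cu cv muv] uv k1n lt_vu; have kn := ltnW k1n.
(* Otherwise each count of the pattern 1,c,1 would be the least one allowed by
   the marginals of the edges {0,k} and {k,k+1}. *)
have [c [x [y [/and3P [x0 /eqP xk x1] /and3P [y0 /eqP yk y1]]]]] : exists c x y,
    [&& u x 0, u x k == c & u x k.+1] /\ [&& ~~ u y 0, u y k == c & ~~ u y k.+1].
  apply: contraPP lt_vu => none; apply/negP; rewrite -leqNgt.
  have no c : triangle u k true c true = 0 \/ triangle u k false c false = 0.
    have [/eqP|/nb_rows_gt0 [x /and3P [/eqP x0 xk /eqP x1]]] :=
      posnP (triangle u k true c true); first by left; apply/eqP.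
    have [->|/nb_rows_gt0 [y /and3P [/eqP y0 yk /eqP y1]]] :=
      posnP (triangle u k false c false); first by right.
    by case: none; exists c, x, y; rewrite x0 xk x1 y0 yk y1.
  rewrite !chord_triangle.
  have := (triangle_prefix true true uv, triangle_prefix true false uv,
           triangle_prefix false true uv, triangle_prefix false false uv).
  have := (triangle_edge true true muv kn, triangle_edge true false muv kn,
           triangle_edge false true muv kn, triangle_edge false false muv kn).
  by case=> [[[? ?] ?] ?] [[[? ?] ?] ?]; case: (no true) (no false) => ? [] ?; lia.
have [[i [ki i_n e]]|none] := pselect (exists i, [/\ k < i, i <= n & u x i = u y i]).
  by apply: chord_decrease_swap ki i_n x0 y0 x1 y1 _ e; rewrite ?xk.
have compl i : k < i -> i <= n -> u y i = ~~ u x i.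
  move=> ki i_n; case: (boolP (u x i == u y i)) => [/eqP e|].
    by case: none; exists i.
  by case: (u x i); case: (u y i).
have [//|stuck] := pselect (exists u',
  [/\ conn n u u', agree k u u' & chord u' k.+1 < chord u k.+1]).
(* If [A] agrees with [x] at [a] and [e] but not at [d] in between, then
   exchanging the arc from [a] to [e] of [A] and [x] makes [x] agree with [y] at
   [d]; the same holds with [x] and [y] interchanged. *)
have chord_swap r s a e d q : k < a -> a < d < e -> e <= n -> r != s -> q != r ->
    q != s -> u r a = u s a -> u r e = u s e -> u s d = u q d ->
    (r = x /\ q = y) \/ (r = y /\ q = x) -> False.
  move=> ka ade en rs qr qs ea ee ed xy; case: stuck.
  have uw : conn n u (swap_arc a e r s u) by exact: conn_swap_arc.
  have w1 : agree k.+1 u (swap_arc a e r s u) by exact: agree_swap_arc.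
  have w0 : agree k u (swap_arc a e r s u) by exact: (agree_swap_arc _ _ _ _ (ltnW _)).
  suff [u' [wu' aw lt]] : exists u', [/\ conn n (swap_arc a e r s u) u',
      agree k (swap_arc a e r s u) u' &
      chord u' k.+1 < chord (swap_arc a e r s u) k.+1].
    exists u'; split; first exact: ConnTrans wu'.
      exact: agree_trans aw.
    by rewrite (chord_agree w1).
  have [cw _ _] := same_fiber_sym (conn_fiber uw).
  have /andP [ad de] := ade.
  have kd := ltn_trans ka ad; have dn := ltnW (leq_trans de en).
  have e0 A : swap_arc a e r s u A 0 = u A 0 by rewrite w1.
  have ek A : swap_arc a e r s u A k = u A k by rewrite w1.
  have e1 A : swap_arc a e r s u A k.+1 = u A k.+1 by rewrite w1.
  apply: (@chord_decrease_swap _ k x y d cw kd dn); rewrite ?e0 ?ek ?e1 ?xk ?yk //.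
  have er : swap_arc a e r s u r d = u q d by rewrite swap_arcL.
  have eq : swap_arc a e r s u q d = u q d by rewrite swap_arcD.
  by case: xy => -[<- <-]; rewrite er eq.
pose rel (w : I -> nat -> bool) A j := w A j (+) u x j.
have flat A : changes (rel u A) k.+1 n = (rel u A k.+1 != rel u A n).
  apply: changes_eq => // d e /andP [ad de] en.
  have kd := ltn_trans (ltnSn k) ad; have dn := ltnW (leq_trans de en).
  have yd : u y d = ~~ u x d by exact: compl.
  have ye : u y e = ~~ u x e by apply: compl; first exact: ltn_trans de.
  rewrite /rel => ea; apply/eqP/negPn/negP => nd.
  case E: (u A e (+) u x e) ea nd => ea nd.
  - apply: (@chord_swap y A k.+1 e d x) => //; first by rewrite ad.
    + by apply: contraTneq nd => <-; rewrite yd; case: (u x d).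
    + by apply: contraTneq x0 => ->.
    + by apply: contraTneq E => <-; rewrite addbb.
    + by move: ea; rewrite x1 (negPf y1); case: (u A _).
    + by move: E; rewrite ye; case: (u A e); case: (u x e).
    + by move: nd; case: (u A d); case: (u x d).
    + by right.
  - apply: (@chord_swap x A k.+1 e d y) => //; first by rewrite ad.
    + by apply: contraTneq nd => <-; rewrite addbb.
    + by apply: contraTneq x0 => <-.
    + by apply: contraFneq E => <-; rewrite ye; case: (u x e).
    + by move: ea; rewrite x1; case: (u A _).
    + by move: E; case: (u A e); case: (u x e).
    + by rewrite yd; move: nd; case: (u A d); case: (u x d).
    + by left.
have total w : \sum_A changes (rel w A) k.+1 n
    = \sum_(k.+1 <= j < n) nb_rows (fun A => rel w A j != rel w A j.+1).
  by rewrite exchange_big.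
have same : \sum_A changes (rel u A) k.+1 n = \sum_A changes (rel v A) k.+1 n.
  rewrite !total; apply: eq_big_nat => j /andP [_ jn].
  exact: (@nb_rows_edge _ u v j (fun a b => a (+) u x j != b (+) u x j.+1)
    (fun a b => muv j a b jn)).
have le : nb_rows (fun A => v A k.+1 != v A 0) <= nb_rows (fun A => u A k.+1 != u A 0).
  have e (w : I -> nat -> bool) A : closed_rows n w ->
      (w A k.+1 != w A 0) = (rel w A k.+1 != rel w A n).
    by move=> cw; rewrite /rel cw cu x0 x1; case: (w A _); case: (w A 0).
  have -> : nb_rows (fun A => u A k.+1 != u A 0) = \sum_A changes (rel u A) k.+1 n.
    by apply: eq_bigr => A _; rewrite flat e.
  rewrite same; apply: leq_sum => A _; rewrite e //; exact: changes_ge.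
have split (w : I -> nat -> bool) : nb_rows (w ^~ 0) + nb_rows (w ^~ k.+1) =
    (chord w k.+1).*2 + nb_rows (fun A => w A k.+1 != w A 0).
  rewrite (@nb_rows_add _ _ (fun A => w A 0 && w A k.+1) (fun A => w A 0 && ~~ w A k.+1)).
    rewrite (@nb_rows_add _ (w ^~ k.+1) (fun A => w A 0 && w A k.+1)
      (fun A => ~~ w A 0 && w A k.+1)).
      rewrite [nb_rows (fun A => _ != _)](@nb_rows_add _ _ (fun A => w A 0 && ~~ w A k.+1)
      (fun A => ~~ w A 0 && w A k.+1)); first by rewrite -/(chord w k.+1); clear; lia.
      by move=> A; case: (w A 0); case: (w A k.+1).
    by move=> A; case: (w A 0); case: (w A k.+1).
  by move=> A; case: (w A 0); case: (w A k.+1).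
have e0 : nb_rows (u ^~ 0) = nb_rows (v ^~ 0) by apply: nb_rows_eq => A; rewrite uv.
have e1 : nb_rows (u ^~ k.+1) = nb_rows (v ^~ k.+1).
  exact: (@nb_rows_edge _ u v k (fun a b => b) (fun a b => muv k a b kn)).
by move: (split u) (split v) e0 e1 le lt_vu; clear; lia.
Qed.
End Chord.

(** * Connectedness of the fibers *)

Section Connect.
Variables (I : finType) (n : nat).
Implicit Types (u v : I -> nat -> bool) (r s q : I) (i k : nat).

(** Within the class [C], as many rows go from 1 to 0 when [P] is replaced by
    [Q] as from 0 to 1. *)
Lemma exchange_partner (C P Q : I -> bool) r :
    nb_rows (fun q => C q && P q) = nb_rows (fun q => C q && Q q) -> C r -> P r != Q r ->
  exists s, [/\ C s, P s = Q r & Q s = P r].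
Proof.
move=> e Cr nPQ; apply/not_existsP => none.
have {}none s : C s -> P s = Q r -> Q s = Q r.
  move=> Cs Ps; case: (eqVneq (Q s) (Q r)) => // nQ; case: (none s); split => //.
  by move: nPQ nQ; case: (P r); case: (Q r); case: (Q s).
have num_class w : nb_rows (fun q => C q && (w q == Q r)) =
    if Q r then nb_rows (fun q => C q && w q) else nb_rows C - nb_rows (fun q => C q && w q).
  case: (Q r); first by apply: nb_rows_eq => q; case: (w q).
  rewrite (@nb_rows_add _ C (fun q => C q && w q) (fun q => C q && ~~ w q)).
    by rewrite addKn; apply: nb_rows_eq => q; case: (w q).
  by move=> q; case: (C q); case: (w q).
have : nb_rows (fun q => C q && (P q == Q r)) < nb_rows (fun q => C q && (Q q == Q r)).
  apply: (@nb_rows_lt _ _ _ r) => [q /andP [Cq /eqP Pq]||].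
  - by rewrite Cq none ?eqxx.
  - by rewrite Cr eqxx.
  - by rewrite (negPf nPQ) andbF.
by rewrite !num_class e ltnn.
Qed.

Lemma mismatch_swap u u' v i r s : (forall q, u' q i = u (tperm r s q) i) ->
  u r i != v r i -> u s i = v r i -> v s i = u r i ->
  nb_rows (fun q => u' q i != v q i) < nb_rows (fun q => u q i != v q i).
Proof.
move=> e ur us vs; apply: (@nb_rows_lt _ _ _ r) => [q||] //.
  rewrite e; case: tpermP => [->|->|//]; first by rewrite us eqxx.
  by rewrite vs eqxx.
by rewrite e tpermL us eqxx.
Qed.

(** Exchanging two whole rows keeps the marginals, so the rows can be ordered in
    such a way that the first columns coincide. *)
Lemma align_first u v : 0 < n -> same_fiber n u v ->
  exists2 u', conn n u u' & agree 0 u' v.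
Proof.
move=> n0; have [m] := ubnP (nb_rows (fun r => u r 0 != v r 0)).
elim: m u => // m IH u; rewrite ltnS => le_m uv.
have [cu cv muv] := uv.
have [mis0|/nb_rows_gt0 [r ur]] := posnP (nb_rows (fun r => u r 0 != v r 0)).
  exists u; first exact: ConnRefl.
  by move=> r i; rewrite leqn0 => /eqP ->; have /negbFE/eqP := nb_rows_eq0 r mis0.
have [|s [_ us vs]] := @exchange_partner xpredT (u ^~ 0) (v ^~ 0) r _ isT ur.
  exact: (@nb_rows_edge _ u v 0 (fun a _ => a) (fun a b => muv 0 a b n0)).
have rs : r != s by apply: contraNneq ur => rs; rewrite -vs -rs.
have uw : conn n u (permute_cols xpredT (tperm r s) u).
  by apply: conn_swap => // i _; exact: Or31.
have [||u' wu' agr] := IH (permute_cols xpredT (tperm r s) u).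
- apply: leq_trans le_m; exact: mismatch_swap us vs.
- exact: same_fiber_trans (same_fiber_sym (conn_fiber uw)) uv.
by exists u' => //; apply: ConnTrans wu'.
Qed.

Lemma triangle_perm u u' k a b c (p : {perm I}) :
  (forall q, u' q 0 = u (p q) 0) -> (forall q, u' q k = u (p q) k) ->
  (forall q, u' q k.+1 = u (p q) k.+1) ->
  triangle u' k a b c = triangle u k a b c.
Proof.
move=> e0 ek e1; rewrite /triangle /nb_rows [RHS](reindex_inj (@perm_inj _ p)) /=.
by apply: eq_bigr => q _; rewrite e0 ek e1.
Qed.

(** When the triangle counts coincide, a row with a wrong value in column
    [k.+1] has a partner with the same values at [0] and [k] and the opposite
    defect; their arcs beyond [k] can be exchanged. *)
Lemma align_next u v k : k.+1 < n -> same_fiber n u v -> agree k u v ->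
    (forall a b c, triangle u k a b c = triangle v k a b c) ->
  exists2 u', conn n u u' & agree k.+1 u' v.
Proof.
move=> k1n; have [m] := ubnP (nb_rows (fun r => u r k.+1 != v r k.+1)).
elim: m u => // m IH u; rewrite ltnS => le_m uv ag tri.
have [cu cv muv] := uv.
have [mis0|/nb_rows_gt0 [r ur]] := posnP (nb_rows (fun r => u r k.+1 != v r k.+1)).
  exists u; first exact: ConnRefl.
  move=> r i; rewrite leq_eqVlt ltnS => /predU1P [->|/ag ->//].
  by have /negbFE/eqP := nb_rows_eq0 r mis0.
pose C q := (u q 0 == u r 0) && (u q k == u r k).
have [||s [/andP [/eqP s0 /eqP sk] us vs]] :=
    @exchange_partner C (u ^~ k.+1) (v ^~ k.+1) r _ _ ur.
- have toC (w : I -> nat -> bool) : agree k u w ->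
      nb_rows (fun q => C q && w q k.+1) = triangle w k (u r 0) (u r k) true.
    by move=> uw; apply: nb_rows_eq => q; rewrite /C eqb_id -andbA !uw.
  by rewrite !toC.
- by rewrite /C !eqxx.
have rs : r != s by apply: contraNneq ur => rs; rewrite -vs -rs.
have kn : k <= n := ltnW (ltnW k1n).
have uw : conn n u (swap_arc k n r s u).
  by apply: conn_swap_arc => //; rewrite !cu.
have wk1 q : swap_arc k n r s u q k.+1 = u (tperm r s q) k.+1.
  by rewrite /swap_arc /permute_cols ltnSn k1n.
have [||||u' wu' agr] := IH (swap_arc k n r s u).
- apply: leq_trans le_m; exact: mismatch_swap us vs.
- exact: same_fiber_trans (same_fiber_sym (conn_fiber uw)) uv.
- by apply: agree_trans ag; apply: agree_sym; exact: agree_swap_arc.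
- move=> a b c; rewrite -tri; apply: (@triangle_perm _ _ _ _ _ _ (tperm r s)) => // q.
    by rewrite swap_arcE ?tperm_agree.
  by rewrite swap_arcE ?ltnn ?tperm_agree.
by exists u' => //; apply: ConnTrans wu'.
Qed.

Lemma double_tperm (a b c d : I) : uniq [:: a; b; c; d] ->
  exists p : {perm I}, [/\ p a = b, p b = a, p c = d, p d = c &
    forall r, r \notin [:: a; b; c; d] -> p r = r].
Proof.
rewrite /= !inE !negb_or => /and4P [/and3P [ab ac ad] /andP [bc bd] cd _].
exists (tperm a b * tperm c d)%g; split=> [||||r]; rewrite ?permM.
- by rewrite tpermL tpermD 1?eq_sym.
- by rewrite tpermR tpermD 1?eq_sym.
- by rewrite (@tpermD _ a b c) // tpermL.
- by rewrite (@tpermD _ a b d) // tpermR.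
- rewrite !inE !negb_or => /and4P [ra rb rc rd].
  by rewrite !tpermD // eq_sym.
Qed.

(** The 2 x 2 x 2 tables with given edge marginals form an arithmetic
    progression whose step is the parity function.  So if [u] has more triangles
    1,1,1 than [v], then all four patterns with an odd number of ones occur in
    [u].  Exchanging the arcs beyond [k] of the rows 1,1,1 and 1,0,0, and those of
    the rows 0,1,0 and 0,0,1, is a move of degree 4. *)
Lemma triangle_decrease u v k : k.+1 < n -> same_fiber n u v -> agree k u v ->
    chord u k.+1 = chord v k.+1 ->
    triangle v k true true true < triangle u k true true true ->
  exists u', [/\ conn n u u', agree k u u', chord u' k.+1 = chord u k.+1 &
    triangle u' k true true true < triangle u k true true true].
Proof.
move=> k1n [cu cv muv] ag ch lt; have kn := ltnW k1n.
have [[tq1 tq2] [tq3 tq4]] :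
    (0 < triangle u k true true true /\ 0 < triangle u k true false false) /\
    (0 < triangle u k false true false /\ 0 < triangle u k false false true).
  move: ch lt; rewrite !chord_triangle.
  have := (triangle_prefix true true ag, triangle_prefix true false ag,
           triangle_prefix false true ag, triangle_prefix false false ag).
  have := (triangle_edge true true muv kn, triangle_edge true false muv kn,
           triangle_edge false true muv kn, triangle_edge false false muv kn).
  by case=> [[[? ?] ?] ?] [[[? ?] ?] ?]; lia.
have [q1 /and3P [/eqP q10 /eqP q1k /eqP q11]] := nb_rows_gt0 tq1.
have [q2 /and3P [/eqP q20 /eqP q2k /eqP q21]] := nb_rows_gt0 tq2.
have [q3 /and3P [/eqP q30 /eqP q3k /eqP q31]] := nb_rows_gt0 tq3.
have [q4 /and3P [/eqP q40 /eqP q4k /eqP q41]] := nb_rows_gt0 tq4.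
have neq i a b : u a i -> u b i = false -> a != b.
  by move=> ua ub; apply: contraTneq ua => ->; rewrite ub.
have n12 : q1 != q2 by exact: (neq k).
have n13 : q1 != q3 by exact: (neq 0).
have n14 : q1 != q4 by exact: (neq 0).
have n23 : q2 != q3 by exact: (neq 0).
have n24 : q2 != q4 by exact: (neq 0).
have n34 : q3 != q4 by exact: (neq k).
have u4 : uniq [:: q1; q2; q3; q4].
  by rewrite /= !inE !negb_or n12 n13 n14 n23 n24 n34.
have u4' : uniq [:: q1; q3; q2; q4].
  by rewrite /= !inE !negb_or n12 n13 n14 (eq_sym q3) n23 n24 n34.
(* The values at k+1 are permuted by [p]; the pairs of values at k and k+1 are
   permuted by another involution [p']. *)
have [p [p1 p2 p3 p4 pD]] := double_tperm u4.
have [p' [p1' p3' p2' p4' pD']] := double_tperm u4'.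
have cases (T : I -> Prop) : T q1 -> T q2 -> T q3 -> T q4 ->
    (forall r, r \notin [:: q1; q2; q3; q4] -> T r) -> forall r, T r.
  move=> T1 T2 T3 T4 TD r; case: (boolP (r \in [:: q1; q2; q3; q4])) => [|/TD //].
  by rewrite !inE => /or4P [] /eqP ->.
have p0 r : u (p r) 0 = u r 0.
  by move: r; apply: cases => [||||r /pD -> //]; rewrite ?p1 ?p2 ?p3 ?p4 ?q10 ?q20 ?q30 ?q40.
pose w := permute_cols (fun i => k < i < n) p u.
have wE i r : ~~ (k < i < n) -> w r i = u r i.
  by rewrite /w /permute_cols => /negPf ->.
have wS i r : k < i < n -> w r i = u (p r) i.
  by rewrite /w /permute_cols => ->.
have cw : closed_rows n w by move=> r; rewrite !wE // ltnn andbF.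
have muw : same_marginals n u w.
  apply: same_marginals_perm => i lt_in.
  have [lt_ik|lt_ki|->] := ltngtP i k.
  - by exists 1%g => r; rewrite perm1 !wE // ltnNge ?lt_ik ?(ltnW lt_ik).
  - exists p => r; rewrite wS ?lt_ki //; split=> //.
    have [E|ne] := eqVneq i.+1 n; last first.
      by rewrite wS // leqW //= ltn_neqAle ne.
    by rewrite E cw cu p0 wE.
  - exists p' => r; rewrite wE ?ltnn // wS ?ltnSn //.
    move: r; apply: cases => [||||r nr].
    + by rewrite p1 p1' q1k q3k q21 q31.
    + by rewrite p2 p2' q2k q4k q11 q41.
    + by rewrite p3 p3' q1k q3k q41 q11.
    + by rewrite p4 p4' q2k q4k q31 q21.
    + rewrite pD // pD' //; move: nr; rewrite !inE !negb_or.
      by case/and4P=> -> -> -> ->.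
have wk1 r : w r k.+1 = u (p r) k.+1 by rewrite wS // ltnSn.
have w0 r : w r 0 = u r 0 by rewrite wE.
have wk r : w r k = u r k by rewrite wE // ltnn.
exists w; split.
- apply: (@ConnMove _ _ [set q in [:: q1; q2; q3; q4]]) => //.
    by rewrite cardsE (card_uniqP u4).
  by move=> r i; rewrite inE /w /permute_cols => /pD ->; rewrite if_same.
- by move=> r i le_ik; rewrite wE // ltnNge le_ik.
- rewrite /chord /nb_rows [RHS](reindex_inj (@perm_inj _ p)) /=.
  by apply: eq_bigr => r _; rewrite w0 wk1 p0.
- apply: (@nb_rows_lt _ _ _ q1) => [r||].
  + rewrite w0 wk wk1; move: r; apply: cases => [||||r /pD ->//].
    * by rewrite p1 q21 !andbF.
    * by rewrite q2k andbF.
    * by rewrite q30.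
    * by rewrite q40.
  + by rewrite q10 q1k q11.
  + by rewrite wk1 p1 q21 !andbF.
Qed.

Lemma conn_agree u v k : n <= k.+1 -> same_fiber n u v -> agree k u v -> conn n u v.
Proof.
move=> nk [cu cv _] ag; apply: ConnRefl => // r i le_in.
have [->|ne] := eqVneq i n; first by rewrite cu cv ag.
by apply: ag; lia.
Qed.

(** The agreement of the two tables is extended column by column.  For the next
    column, the chord from [0] is adjusted first, always lowering the larger of
    the two marginals; then the number of triangles 1,1,1 is adjusted in the same
    way; all the triangle counts are then equal and the columns can be
    aligned. *)
Theorem conn_same_fiber u v : 0 < n -> same_fiber n u v -> conn n u v.
Proof.
suff main d k : forall u v, n <= k + d.+1 -> same_fiber n u v -> agree k u v ->
    conn n u v.
  move=> n0 uv; have [u' uu' ag] := align_first n0 uv.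
  apply: (ConnTrans uu'); apply: (main n 0) ag; first by lia.
  exact: same_fiber_trans (same_fiber_sym (conn_fiber uu')) uv.
elim: d k {u v} => [|d IH] k u0 v0 le.
  by apply: conn_agree; lia.
have [nk1|k1n] := leqP n k.+1; first exact: conn_agree.
have conn_chord_corner u v : same_fiber n u v -> agree k u v ->
    chord u k.+1 = chord v k.+1 ->
    triangle u k true true true = triangle v k true true true -> conn n u v.
  move=> uv ag ch tr; have [_ _ muv] := uv.
  have [u' uu' ag'] : exists2 u', conn n u u' & agree k.+1 u' v.
    apply: align_next => // a b c.
    move: ch tr; rewrite !chord_triangle.
    have := (triangle_prefix true true ag, triangle_prefix true false ag,
           triangle_prefix false true ag, triangle_prefix false false ag).
    have := (triangle_edge true true muv (ltnW k1n), triangle_edge true false muv (ltnW k1n),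
           triangle_edge false true muv (ltnW k1n), triangle_edge false false muv (ltnW k1n)).
    by case=> [[[? ?] ?] ?] [[[? ?] ?] ?]; case: a; case: b; case: c; lia.
  apply: (ConnTrans uu'); apply: (IH k.+1) ag'; first by lia.
  exact: same_fiber_trans (same_fiber_sym (conn_fiber uu')) uv.
have conn_chord m u v : triangle u k true true true + triangle v k true true true < m ->
    same_fiber n u v -> agree k u v -> chord u k.+1 = chord v k.+1 -> conn n u v.
  elim: m u v => // m IHm u v; rewrite ltnS => le_m uv ag ch.
  wlog : u v le_m uv ag ch / triangle v k true true true <= triangle u k true true true.
    move=> th; have [|/ltnW] := leqP (triangle v k true true true) (triangle u k true true true).
      exact: th.
    move=> le'; apply: ConnSym; apply: th => //.
    - by rewrite addnC.
    - exact: same_fiber_sym.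
    - exact: agree_sym.
  rewrite leq_eqVlt => /predU1P [/esym|lt]; first exact: conn_chord_corner.
  have [u' [uu' ag' ch' lt']] := triangle_decrease k1n uv ag ch lt.
  apply: (ConnTrans uu'); apply: IHm.
  - by lia.
  - exact: same_fiber_trans (same_fiber_sym (conn_fiber uu')) uv.
  - exact: agree_trans (agree_sym ag') ag.
  - by rewrite ch'.
suff conn_all m u v : chord u k.+1 + chord v k.+1 < m ->
    same_fiber n u v -> agree k u v -> conn n u v by exact: (conn_all _ u0 v0 (ltnSn _)).
elim: m u v => // m IHm u v; rewrite ltnS => le_m uv ag.
wlog : u v le_m uv ag / chord v k.+1 <= chord u k.+1.
  move=> th; have [|/ltnW] := leqP (chord v k.+1) (chord u k.+1).
    exact: th.
  move=> le'; apply: ConnSym; apply: th => //.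
  - by rewrite addnC.
  - exact: same_fiber_sym.
  - exact: agree_sym.
rewrite leq_eqVlt => /predU1P [/esym ch|lt]; first exact: (conn_chord _ u v (ltnSn _)).
have [u' [uu' ag' lt']] := chord_decrease uv ag k1n lt.
apply: (ConnTrans uu'); apply: IHm.
- by lia.
- exact: same_fiber_trans (same_fiber_sym (conn_fiber uu')) uv.
- exact: agree_trans (agree_sym ag') ag.
Qed.
End Connect.

Import GRing.Theory.
Local Open Scope classical_set_scope.
Local Open Scope ring_scope.

(** * Homogeneous generators and the Markov width *)

Section Ideals.
Variables (K : fieldType) (N : nat).
Implicit Types (S T : set {mpoly K[N]}) (f g c : {mpoly K[N]}).

Lemma span_gen S f : S f -> ideal_span S f.
Proof.
by move=> Sf; exists 1%N, (fun=> 1), (fun=> f); split=> //; rewrite big_ord1 mul1r.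
Qed.

Lemma span0 S : ideal_span S 0.
Proof. by exists 0%N, (fun=> 0), (fun=> 0); split=> [[]|] //; rewrite big_ord0. Qed.

Lemma spanD S f g : ideal_span S f -> ideal_span S g -> ideal_span S (f + g).
Proof.
move=> [m [c [a [Sa ->]]]] [m' [c' [a' [Sa' ->]]]].
exists (m + m')%N, (fun i => match fintype.split i with inl j => c j | inr j => c' j end),
  (fun i => match fintype.split i with inl j => a j | inr j => a' j end); split.
  by move=> i; case: (fintype.split i).
rewrite big_split_ord /=; congr (_ + _); apply: eq_bigr => i _.
  by rewrite (unsplitK (inl i)).
by rewrite (unsplitK (inr i)).
Qed.

Lemma spanM S c f : ideal_span S f -> ideal_span S (c * f).
Proof.
move=> [m [b [a [Sa ->]]]]; exists m, (fun i => c * b i), a; split=> //.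
by rewrite mulr_sumr; apply: eq_bigr => i _; rewrite mulrA.
Qed.

Lemma span_sum S (J : Type) (r : seq J) (P : pred J) (F : J -> {mpoly K[N]}) :
  (forall i, P i -> ideal_span S (F i)) -> ideal_span S (\sum_(i <- r | P i) F i).
Proof. by move=> h; apply: big_ind => //; [exact: span0|exact: spanD]. Qed.

Lemma span_least S T : S `<=` ideal_span T -> ideal_span S `<=` ideal_span T.
Proof.
by move=> ST f [m [c [a [Sa ->]]]]; apply: span_sum => i _; exact/spanM/ST.
Qed.

Lemma span_mono S T : S `<=` T -> ideal_span S `<=` ideal_span T.
Proof. by move=> ST; apply: span_least => f /ST; exact: span_gen. Qed.

(** A finite generating set that is not minimal contains a strictly smaller
    one. *)
Lemma exists_minimal_generators (s : seq {mpoly K[N]}) :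
  (forall f, f \in s -> exists d, f \is d.-homog) ->
  exists S, minimal_homog_generators (ideal_span [set` s]) S.
Proof.
have [m] := ubnP (size s); elim: m s => // m IH s; rewrite ltnS => le_m hom.
have [min|/existsNP [T /not_implyP [Ts /not_implyP [eT neT]]]] := pselect (forall T,
    T `<=` [set` s] -> ideal_span T = ideal_span [set` s] -> T = [set` s]).
  by exists [set` s].
pose s' := [seq f <- s | `[< T f >]].
have Ts' : [set` s'] = T.
  apply/seteqP; split=> f /=; first by rewrite mem_filter => /andP [/asboolP].
  by move=> Tf; rewrite mem_filter; apply/andP; split; [exact/asboolP|exact: Ts].
rewrite -eT -Ts'; apply: IH; last by move=> f; rewrite mem_filter => /andP [_ /hom].
apply: leq_trans le_m; rewrite size_filter ltn_neqAle count_size andbT -all_count.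
apply/negP => /allP sT; apply: neT; apply/seteqP; split=> // f /= /sT.
by move/asboolP.
Qed.

(** The cofactor is the part of [c] of degree [d - e], written as a sum that is
    empty when [d < e]. *)
Lemma pihomog_mul c f e d : f \is e.-homog ->
  exists2 c', pihomog mdeg d (c * f) = c' * f & ((d < e)%N -> c' = 0).
Proof.
move=> hf; exists (\sum_(i < msize c | (i + e)%N == d) pihomog mdeg i c); last first.
  by move=> lt; rewrite big1 // => i; lia.
rewrite [in LHS](pihomog_partitionE (leqnn (msize c))) mulr_suml linear_sum /=.
rewrite [in RHS]big_mkcond mulr_suml; apply: eq_bigr => i _ /=.
have hif : pihomog mdeg i c * f \is (i + e).-homog by apply/dhomogM/hf; exact: pihomogP.
case: eqP => [E|/eqP ne]; first by rewrite pihomog_dE // -E.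
by rewrite mul0r (pihomog_ne0 ne hif).
Qed.

Lemma tdegree_homog f d : f \is d.-homog -> f != 0 -> tdegree f = d.
Proof.
move=> hf f0; rewrite /tdegree -(mlead_deg f0) /=.
by have /dhomogP := hf; apply; exact: mlead_supp.
Qed.

(** A generator [f] of degree greater than [d0] is redundant: in each expression
    of an element of [s] by generators, the part of the relevant degree does not
    involve [f]. *)
Lemma generator_degree_le (I S : set {mpoly K[N]}) (s : seq {mpoly K[N]}) d0 :
    I = ideal_span [set` s] ->
    (forall f, f \in s -> exists2 d, (d <= d0)%N & f \is d.-homog) ->
    minimal_homog_generators I S ->
  forall f, S f -> (tdegree f <= d0)%N.
Proof.
move=> eI hom [Shom eS min] f Sf; rewrite leqNgt; apply/negP => lt.
have f0 : f != 0 by apply: contraTneq lt => ->; rewrite /tdegree msize0.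
have sub : S `\ f `<=` S by move=> g [].
suff /min : ideal_span (S `\ f) = I.
  by move=> /(_ sub) e; move: Sf; rewrite -e => -[_]; apply.
apply/seteqP; split; first by rewrite -eS; apply: span_mono.
rewrite eI; apply: span_least => g /= gs.
have [d le_d hg] := hom g gs.
have : ideal_span S g by rewrite eS eI; exact: span_gen.
move=> [m [c [a [Sa eg]]]].
rewrite -(pihomog_dE hg) eg linear_sum /=; apply: span_sum => i _.
have [e he] := Shom _ (Sa i).
have [c' -> c'0] := pihomog_mul (c i) d he.
have [E|ne] := pselect (a i = f); last by apply/spanM/span_gen; split.
rewrite c'0 ?mul0r; first exact: span0.
by rewrite -(tdegree_homog he) E //; lia.
Qed.

(** If every element of a minimal generating set had degree less than [d0], the
    ideal would be generated by its elements of degree less than [d0]. *)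
Lemma markov_width_intro (I : set {mpoly K[N]}) (s : seq {mpoly K[N]}) d0 :
    I = ideal_span [set` s] ->
    (forall f, f \in s -> exists2 d, (d <= d0)%N & f \is d.-homog) ->
    ~ (I `<=` ideal_span [set f | I f /\ (tdegree f < d0)%N]) ->
  has_markov_width I d0.
Proof.
move=> eI hom low; split.
  by rewrite eI; apply: exists_minimal_generators => f /hom [d _ hf]; exists d.
move=> S minS; have deg := generator_degree_le eI hom minS; split=> //.
have [_ eS _] := minS.
apply: contrapT => none; apply: low; rewrite -{1}eS; apply: span_mono => f Sf.
split; first by rewrite -eS; exact: span_gen.
rewrite ltn_neqAle deg // andbT; apply/eqP => E; apply: none.
by exists f.
Qed.
End Ideals.

(** * Graph ideals are spanned by binomials *)

Section GraphExponents.
Variables (K : fieldType) (n : nat) (G : sgraph n).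
Implicit Types (x : state n) (m : 'X_{1..#|state n|}) (s t : seq (state n)).
Local Notation phi := (@graph_morphism K n G).
Local Notation pvar x := ('X_(enum_rank x) : {mpoly K[#|state n|]}).

HB.instance Definition _ := GRing.RMorphism.copy (@graph_morphism K n G)
  (mmap (@mpolyC #|param G| K)
       (fun i : 'I_#|state n| => param_monomial K G (enum_val i))).

Definition param_exp x : 'X_{1..#|param G|} :=
  (\sum_(e : edge G) U_(enum_rank (inl (e, (x (val e).1, x (val e).2)) : param G))
   + \sum_(l : isolated G) U_(enum_rank (inr (l, x (val l)) : param G)))%MM.

Lemma param_monomialE x : param_monomial K G x = 'X_[param_exp x].
Proof. by rewrite /param_exp mpolyXD -!mprodXE. Qed.

Lemma param_exp_edge x (e : edge G) a b :
  param_exp x (enum_rank (inl (e, (a, b)) : param G))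
    = ((x (val e).1 == a) && (x (val e).2 == b)) :> nat.
Proof.
rewrite mnmDE !mnm_sumE [X in (_ + X)%N]big1 => [|l _]; last first.
  by rewrite mnm1E (inj_eq enum_rank_inj).
rewrite addn0 (bigD1 e) //= big1 => [|e' ne]; last first.
  rewrite mnm1E (inj_eq enum_rank_inj) /eq_op /= xpair_eqE.
  by rewrite (negPf ne).
by rewrite mnm1E (inj_eq enum_rank_inj) addn0 /eq_op /= !xpair_eqE eqxx.
Qed.

(** The graph morphism sends monomials to monomials; this is its effect on
    exponents. *)
Definition monomial_exp m : 'X_{1..#|param G|} :=
  (\sum_i param_exp (enum_val i) *+ m i)%MM.

Lemma graph_morphismX m : phi 'X_[m] = 'X_[monomial_exp m].
Proof.
rewrite /graph_morphism mmapX /mmap1 /monomial_exp -mprodXnE.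
by apply: eq_bigr => i _; rewrite param_monomialE.
Qed.

Lemma graph_morphismE f :
  phi f = \sum_(m <- msupp f) f@_m *: 'X_[monomial_exp m].
Proof.
apply: eq_bigr => m _; rewrite mul_mpolyC; congr (_ *: _).
by rewrite -graph_morphismX /graph_morphism mmapX.
Qed.

Lemma monomial_exp_edge m (e : edge G) a b :
  monomial_exp m (enum_rank (inl (e, (a, b)) : param G))
  = (\sum_x m (enum_rank x) * ((x (val e).1 == a) && (x (val e).2 == b)))%N.
Proof.
rewrite mnm_sumE (reindex (@enum_rank (state n))) /=; last first.
  by apply: onW_bij; exact: enum_rank_bij.
apply: eq_bigr => x _; rewrite mulmnE enum_rankK param_exp_edge.
by rewrite mulnC.
Qed.

Definition word_monomial s : {mpoly K[#|state n|]} := \prod_(x <- s) pvar x.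

Lemma graph_morphism_word s :
  phi (word_monomial s) = 'X_[(\sum_(x <- s) param_exp x)%MM].
Proof.
transitivity (\prod_(x <- s) phi (pvar x)); first exact: rmorph_prod.
rewrite -mprodXE; apply: eq_bigr => x _.
rewrite graph_morphismX /monomial_exp; congr 'X_[_].
rewrite (bigD1 (enum_rank x)) //= big1 => [|i ne].
  by rewrite mnm1E eqxx mulm1n enum_rankK addm0.
by rewrite mnm1E eq_sym (negPf ne) mulm0n.
Qed.

Lemma mpolyX_inj (N : nat) : injective (fun m : 'X_{1..N} => 'X_[m] : {mpoly K[N]}).
Proof.
move=> m m' /(congr1 (fun p : {mpoly K[N]} => p@_m)); rewrite !mcoeffX eqxx.
by case: eqP => // _ /eqP; rewrite oner_eq0.
Qed.

Lemma word_of_monomial m : exists s, 'X_[m] = word_monomial s.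
Proof.
have [d] := ubnP (mdeg m); elim: d m => // d IH m; rewrite ltnS => le_d.
have [->|m0] := eqVneq m 0%MM.
  by exists [::]; rewrite /word_monomial big_nil mpolyX0.
have [i mi] : exists i, m i != 0%N.
  apply/existsP; apply: contraNT m0 => /existsPn h.
  by apply/eqP/mnmP => i; rewrite mnm0E; apply/eqP/negPn/h.
have le : (U_(i) <= m)%MM by rewrite lep1mP.
have [|s es] := IH (m - U_(i))%MM.
  apply: leq_trans le_d; rewrite -[in ltnRHS](submK le) mdegD mdeg1.
  by rewrite addn1.
exists (enum_val i :: s); rewrite /word_monomial big_cons -/(word_monomial s).
by rewrite -es enum_valK -mpolyXD addmC submK.
Qed.

(** Otherwise the image of the monomial [m] would not be cancelled in the image
    of [f]. *)
Lemma support_partner (f : {mpoly K[#|state n|]}) m :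
  graph_ideal K G f -> m \in msupp f ->
  exists m', [/\ m' \in msupp f, m' != m & monomial_exp m' = monomial_exp m].
Proof.
move=> If mf; apply/not_existsP => none.
have : (phi f)@_(monomial_exp m) = f@_m.
  rewrite graph_morphismE raddf_sum /= (bigD1_seq m) ?msupp_uniq //=.
  rewrite mcoeffZ mcoeffX eqxx mulr1 big_seq_cond big1 ?addr0 // => m' /andP [m'f ne].
  rewrite mcoeffZ mcoeffX.
  by case: eqP => [e|_]; [case: (none m')|rewrite mulr0].
rewrite (If : phi f = 0) mcoeff0 => /esym/eqP.
by rewrite mcoeff_eq0 mf.
Qed.

(** Subtracting a multiple of the binomial formed by the leading monomial and a
    partner of it makes the support smaller. *)
Lemma ideal_of_binomials (S : set {mpoly K[#|state n|]}) :
  (forall m m', monomial_exp m = monomial_exp m' ->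
     ideal_span S ('X_[m] - 'X_[m'])) ->
  graph_ideal K G `<=` ideal_span S.
Proof.
move=> hS f; have [d] := ubnP (size (msupp f)).
elim: d f => // d IH f; rewrite ltnS => le_d If.
have [->|f0] := eqVneq f 0; first exact: span0.
have mf := mlead_supp f0; set m := mlead f in mf.
have [m' [m'f ne e]] := support_partner If mf.
have Sm : ideal_span S (f@_m *: ('X_[m] - 'X_[m'])).
  by rewrite -mul_mpolyC; apply: spanM; apply: hS.
rewrite -[f](subrK (f@_m *: ('X_[m] - 'X_[m']))); apply: spanD => //.
set g := f - _; apply: IH; last first.
  rewrite /graph_ideal /= rmorphB /= (If : phi f = 0) -mul_mpolyC rmorphM rmorphB /=.
  by rewrite !graph_morphismX e subrr mulr0 subrr.
apply: leq_trans le_d.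
have gm : m \notin msupp g.
  rewrite -mcoeff_eq0 mcoeffB mcoeffZ mcoeffB !mcoeffX eqxx (negPf ne).
  by rewrite subr0 mulr1 subrr.
have /uniq_leq_size : {subset m :: msupp g <= msupp f}.
  move=> k; rewrite inE => /predU1P [->//|kg].
  rewrite mcoeff_msupp; apply: contraTneq kg => fk.
  rewrite mcoeff_msupp negbK mcoeffB fk mcoeffZ mcoeffB !mcoeffX.
  have -> : (m == k) = false by apply: contraTF mf => /eqP ->; rewrite mcoeff_msupp fk eqxx.
  have -> : (m' == k) = false by apply: contraTF m'f => /eqP ->; rewrite mcoeff_msupp fk eqxx.
  by rewrite subrr mulr0 subrr.
by rewrite /= gm msupp_uniq; apply.
Qed.

End GraphExponents.

(** * Generators of the ideal of a cycle *)

Section CycleGraph.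
Variables (K : fieldType) (n : nat).
Hypothesis n_ge3 : (3 <= n)%N.
Implicit Types (x : state n) (s t : seq (state n)).
Local Notation G := (cycle_graph n).
Local Notation phi := (@graph_morphism K n G).
Local Notation pvar x := ('X_(enum_rank x) : {mpoly K[#|state n|]}).

Let n_gt0 : (0 < n)%N. Proof. exact: leq_trans n_ge3. Qed.

Lemma cycle_edge (e : edge G) :
  (val e).1.+1 = (val e).2 :> nat \/
  (val e).1 = 0%N :> nat /\ (val e).2.+1 = n :> nat.
Proof.
case: e => -[i j] /=; rewrite /is_edge /= /cycle_adj => /andP [/andP [_ adj_ij] lt_ij].
have lt_j := ltn_ord j.
case/orP: adj_ij => /eqP; first by rewrite modn_small; [left|exact: leq_ltn_trans lt_j].
have [E|ne] := eqVneq j.+1 n; first by rewrite E modnn; right.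
by rewrite modn_small; lia.
Qed.

(** The infinite periodic word with period [x]. *)
Definition cyc (x : state n) (i : nat) : bool := x (Ordinal (ltn_pmod i n_gt0)).

Definition state_of (w : nat -> bool) : state n := [ffun i : 'I_n => w i].

Lemma cycK x : state_of (cyc x) = x.
Proof.
apply/ffunP => i; rewrite ffunE /cyc; congr (x _).
by apply: val_inj; rewrite /= modn_small.
Qed.

Lemma cyc_closed x : cyc x n = cyc x 0.
Proof. by congr (x _); apply: val_inj; rewrite /= modnn mod0n. Qed.

Definition table_monomial (I : finType) (u : I -> nat -> bool) :
  {mpoly K[#|state n|]} := \prod_r pvar (state_of (u r)).

Lemma graph_morphism_table (I : finType) (u : I -> nat -> bool) :
  phi (table_monomial u) = \prod_r param_monomial K G (state_of (u r)).
Proof.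
rewrite /table_monomial.
transitivity (\prod_r phi (pvar (state_of (u r)))); first exact: rmorph_prod.
apply: eq_bigr => r _; rewrite graph_morphismE msuppX big_seq1 mcoeffX eqxx scale1r.
have := graph_morphism_word K G [:: state_of (u r)].
rewrite /word_monomial !big_seq1 graph_morphismE msuppX big_seq1 mcoeffX eqxx scale1r.
by move=> ->; rewrite param_monomialE.
Qed.

(** For a fixed edge, the product over the rows of the parameters of this edge
    is determined by the marginal of the edge. *)
Lemma same_fiber_image (I : finType) (u v : I -> nat -> bool) :
  same_fiber n u v -> phi (table_monomial u) = phi (table_monomial v).
Proof.
move=> [cu cv muv]; rewrite !graph_morphism_table /param_monomial !big_split /=.
congr (_ * _); rewrite exchange_big [RHS]exchange_big /=.
  apply: eq_bigr => e _; have [je|[i0 jn]] := cycle_edge e.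
    have := @big_edge I _ 1 *%R u v (val e).1
      (fun a b => tvar K (inl (e, (a, b))) : {mpoly K[#|param G|]})
      (fun a b => muv _ a b (ltn_ord _)).
    by move=> h; apply: etrans (etrans h _); apply: eq_bigr => r _; rewrite !ffunE je.
  have := @big_edge I _ 1 *%R u v (val e).2
    (fun a b => tvar K (inl (e, (b, a))) : {mpoly K[#|param G|]})
    (fun a b => muv _ a b (ltn_ord _)).
  move=> h; apply: etrans (etrans h _); apply: eq_bigr => r _; rewrite !ffunE jn i0.
    by rewrite cu.
  by rewrite cv.
apply: eq_bigr => l _.
have h := @big_edge I _ 1 *%R u v (val l)
    (fun a b => tvar K (inr (l, a)) : {mpoly K[#|param G|]})
    (fun a b => muv _ a b (ltn_ord _)).
by apply: etrans (etrans h _); apply: eq_bigr => r _; rewrite !ffunE.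
Qed.

Lemma is_edge_succ (i j : 'I_n) : i.+1 = j :> nat -> is_edge G (i, j).
Proof.
move=> ij; rewrite /is_edge /= /cycle_adj -ij ltnSn andbT -val_eqE /=.
by rewrite -ij neq_ltn ltnSn /= modn_small ?eqxx // ij.
Qed.

Lemma is_edge_last (i j : 'I_n) : i = 0%N :> nat -> j.+1 = n :> nat -> is_edge G (i, j).
Proof.
move=> i0 jn; have j0 : (0 < j)%N by rewrite -ltnS jn ltnW.
rewrite /is_edge /= /cycle_adj i0 j0 andbT -val_eqE /= i0.
by rewrite jn modnn eqxx orbT andbT neq_ltn j0.
Qed.

Definition edge_succ i (lt_i : (i.+1 < n)%N) : edge G :=
  exist _ (Ordinal (ltnW lt_i), Ordinal lt_i)
    (@is_edge_succ (Ordinal (ltnW lt_i)) (Ordinal lt_i) erefl).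

Lemma last_proof : (n.-1 < n)%N. Proof. by rewrite prednK. Qed.

Definition edge_last : edge G :=
  exist _ (Ordinal n_gt0, Ordinal last_proof)
    (@is_edge_last (Ordinal n_gt0) (Ordinal last_proof) erefl (prednK n_gt0)).

Lemma table_monomial_cyc (I : finType) (f : I -> state n) :
  table_monomial (fun r => cyc (f r)) = word_monomial K (map f (enum I)).
Proof.
rewrite /word_monomial big_map big_enum; apply: eq_bigr => r _.
by rewrite cycK.
Qed.

Definition edge_pairs s (e : edge G) a b : nat :=
  \sum_(x <- s) ((x (val e).1 == a) && (x (val e).2 == b)).

(** An edge marginal can be read off the exponents of the parameters of that
    edge. *)
Lemma edge_pairs_eq s t e a b : phi (word_monomial K s) = phi (word_monomial K t) ->
  edge_pairs s e a b = edge_pairs t e a b.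
Proof.
rewrite !graph_morphism_word => /(@mpolyX_inj K).
move=> /(congr1 (fun m : 'X_{1..#|param G|} => m (enum_rank (inl (e, (a, b)) : param G)))).
rewrite !mnm_sumE; under eq_bigr do rewrite param_exp_edge.
by under [in RHS]eq_bigr do rewrite param_exp_edge.
Qed.

Lemma size_edge_pairs s e : size s =
  (edge_pairs s e false false + edge_pairs s e false true +
   edge_pairs s e true false + edge_pairs s e true true)%N.
Proof.
rewrite /edge_pairs -!big_split /= -sum1_size; apply: eq_bigr => x _.
by case: (x _); case: (x _).
Qed.

Lemma edge_pairs_table s (I : finType) (f : I -> state n) e a b :
  s = map f (enum I) ->
  edge_pairs s e a b =
    nb_rows (fun r => (f r (val e).1 == a) && (f r (val e).2 == b)).
Proof. by move=> ->; rewrite /edge_pairs big_map big_enum. Qed.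

Lemma table_fiber (I : finType) (f g : I -> state n) :
  (forall e a b, edge_pairs (map f (enum I)) e a b = edge_pairs (map g (enum I)) e a b) ->
  same_fiber n (fun r => cyc (f r)) (fun r => cyc (g r)).
Proof.
move=> h; split=> [r|r|i a b lt_in]; try exact: cyc_closed.
have cycE x k (lt_k : (k < n)%N) : cyc x k = x (Ordinal lt_k).
  by congr (x _); apply: val_inj; rewrite /= modn_small.
have [E|ne] := eqVneq i.+1 n.
  have := h edge_last b a; rewrite !(edge_pairs_table _ _ _ erefl) /=.
  have x0 x : cyc x i.+1 = x (Ordinal n_gt0) by rewrite E cyc_closed cycE.
  have xi x : cyc x i = x (Ordinal last_proof).
    by congr (x _); apply: val_inj; rewrite /= modn_small // -[n in RHS]E.
  have tab (k : I -> state n) : edge_count (fun r => cyc (k r)) i a b =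
      nb_rows (fun r => (k r (Ordinal n_gt0) == b) && (k r (Ordinal last_proof) == a)).
    by apply: nb_rows_eq => r; rewrite x0 xi andbC.
  by rewrite !tab.
have lt_i : (i.+1 < n)%N by rewrite ltn_neqAle ne.
have := h (edge_succ lt_i) a b; rewrite !(edge_pairs_table _ _ _ erefl) /=.
have tab (k : I -> state n) : edge_count (fun r => cyc (k r)) i a b =
    nb_rows (fun r => (k r (Ordinal (ltnW lt_i)) == a) && (k r (Ordinal lt_i) == b)).
  by apply: nb_rows_eq => r; rewrite (cycE _ _ (ltnW lt_i)) (cycE _ _ lt_i).
by rewrite !tab.
Qed.

Definition word_binomial s t := word_monomial K s - word_monomial K t.

Definition cycle_generators : seq {mpoly K[#|state n|]} :=
  [seq f <- [seq word_binomial p.1 p.2 | p : 2.-tuple (state n) * 2.-tuple (state n)] ++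
            [seq word_binomial p.1 p.2 | p : 4.-tuple (state n) * 4.-tuple (state n)]
   | `[< graph_ideal K G f >]].

Lemma word_monomial_homog d (s : d.-tuple (state n)) : word_monomial K s \is d.-homog.
Proof.
rewrite /word_monomial mprodXE dhomogX; apply/eqP; rewrite [LHS]mdeg_sum.
under eq_bigr do rewrite mdeg1.
by rewrite sum1_size size_tuple.
Qed.

Lemma cycle_generators_homog f : f \in cycle_generators ->
  graph_ideal K G f /\ (f \is 2.-homog \/ f \is 4.-homog).
Proof.
rewrite mem_filter mem_cat => /andP [/asboolP If /orP [] /mapP [p _ ef]];
  split=> //; rewrite ef;
  [left|right]; exact: rpredB (word_monomial_homog _) (word_monomial_homog _).
Qed.

Lemma word_binomial_generator s t : size s \in [:: 2; 4] -> size t = size s ->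
  graph_ideal K G (word_binomial s t) -> word_binomial s t \in cycle_generators.
Proof.
rewrite !inE => size_s ts Ist; rewrite mem_filter; apply/andP; split; first exact/asboolP.
rewrite mem_cat; case/orP: size_s => /eqP sz; apply/orP; [left|right];
  have st := eqxx (size s); rewrite sz in ts;
  by apply/mapP; exists (Tuple (introT eqP sz), Tuple (introT eqP ts)); rewrite ?mem_enum.
Qed.

(** For a move, the common rows can be factored out of the binomial.  The image
    of this common factor is not zero, so the binomial of the altered rows lies
    in the ideal. *)
Lemma conn_binomial (I : finType) (u v : I -> nat -> bool) : conn n u v ->
  ideal_span [set` cycle_generators] (table_monomial u - table_monomial v).
Proof.
elim=> {u v} [A u v cA cu cv muv uv|u v cu e|u v _ h|v u w _ h1 _ h2].
- have image := same_fiber_image (And3 cu cv muv).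
  pose out : {mpoly K[#|state n|]} := \prod_(r | r \notin A) pvar (state_of (u r)).
  pose ins (w : I -> nat -> bool) := [seq state_of (w r) | r <- enum A].
  have split_u : table_monomial u = out * word_monomial K (ins u).
    by rewrite /table_monomial (bigID (mem A)) /= mulrC /word_monomial big_map big_enum.
  have split_v : table_monomial v = out * word_monomial K (ins v).
    rewrite /table_monomial (bigID (mem A)) /= mulrC /word_monomial big_map big_enum.
    congr (_ * _); apply: eq_bigr => r rA; congr ('X_(enum_rank _)).
    by apply/ffunP => i; rewrite !ffunE uv.
  rewrite split_u split_v -mulrBr; apply/spanM/span_gen => /=.
  apply: word_binomial_generator; rewrite ?size_map -?cardE //.
  rewrite /graph_ideal /= rmorphB /=.
  move: image; rewrite split_u split_v !rmorphM /= => /mulfI -> //.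
    by rewrite subrr.
  by rewrite /out mprodXE graph_morphismX -msupp_eq0 msuppX.
- suff -> : table_monomial u = table_monomial v by rewrite subrr; exact: span0.
  apply: eq_bigr => r _; congr ('X_(enum_rank _)).
  by apply/ffunP => i; rewrite !ffunE e // ltnW.
- by rewrite -opprB -mulN1r; exact: spanM.
- by rewrite -[X in X - _](subrK (table_monomial v)) -addrA; exact: spanD.
Qed.

(** The images of two monomials coincide only if their tables have the same
    number of rows and the same marginals; such tables are connected. *)
Theorem cycle_ideal_generated : graph_ideal K G = ideal_span [set` cycle_generators].
Proof.
apply/seteqP; split.
  apply: ideal_of_binomials => m m' e.
  have [s es] := word_of_monomial K m; have [t et] := word_of_monomial K m'.
  have image : phi (word_monomial K s) = phi (word_monomial K t).
    by rewrite -es -et !graph_morphismX e.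
  have sz : size t = size s.
    by rewrite !(size_edge_pairs _ edge_last) !(edge_pairs_eq _ _ _ image).
  pose f := tnth (in_tuple s); pose g := tnth (Tuple (introT eqP sz)).
  have ef : s = map f (enum 'I_(size s)) by rewrite map_tnth_enum.
  have eg : t = map g (enum 'I_(size s)) by rewrite map_tnth_enum.
  have fib : same_fiber n (fun r => cyc (f r)) (fun r => cyc (g r)).
    by apply: table_fiber => e' a b; rewrite -ef -eg; exact: edge_pairs_eq.
  by rewrite es et {1}ef eg -!table_monomial_cyc; apply/conn_binomial/conn_same_fiber.
move=> f [m [c [a [ga ->]]]]; rewrite /graph_ideal /= rmorph_sum big1 // => i _.
have [Ia _] := cycle_generators_homog (ga i).
by rewrite rmorphM /= (Ia : phi _ = 0) mulr0.
Qed.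
End CycleGraph.

(** * A quartic that lower degrees do not generate *)

Section LowerBound.
Variables (K : fieldType) (n : nat).
Hypothesis n_ge3 : (3 <= n)%N.
Implicit Types (x : state n) (m : 'X_{1..#|state n|}).
Local Notation G := (cycle_graph n).
Local Notation phi := (@graph_morphism K n G).

(** The words which are constant on the vertices [2], ..., [n.-1]: contracting
    these vertices identifies them with the words of the triangle. *)
Definition flat_tail a b c : state n :=
  [ffun i : 'I_n => if i == 0 :> nat then a else if i == 1 :> nat then b else c].

Definition vertex i (lt_i : (i < 3)%N) : 'I_n := Ordinal (leq_trans lt_i n_ge3).
Local Notation v0 := (@vertex 0 isT).
Local Notation v1 := (@vertex 1 isT).
Local Notation v2 := (@vertex 2 isT).

(** The word with first letters [ab] and constant tail whose three letters sum
    to [p] modulo 2. *)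
Definition parity_state (p : bool) (ab : bool * bool) : state n :=
  flat_tail ab.1 ab.2 (p (+) ab.1 (+) ab.2).

Definition parity_word p := map (parity_state p) (enum {: bool * bool}).

Lemma flat_tail_inj a b c a' b' c' :
  flat_tail a b c = flat_tail a' b' c' -> [/\ a = a', b = b' & c = c'].
Proof.
move=> /ffunP e.
by have := e v0; have := e v1; have := e v2; rewrite !ffunE.
Qed.

Lemma parity_state_inj p : injective (parity_state p).
Proof. by move=> [a b] [a' b'] /flat_tail_inj [/= -> -> _]. Qed.

Lemma parity_word_pairs e a b :
  edge_pairs (parity_word true) e a b = edge_pairs (parity_word false) e a b.
Proof.
rewrite !(edge_pairs_table _ _ _ erefl) /nb_rows.
rewrite -!(pair_bigA _ (fun c d => nat_of_bool
  ((parity_state _ (c, d) (val e).1 == a) && (parity_state _ (c, d) (val e).2 == b)))) /=.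
rewrite !big_bool /parity_state /flat_tail !ffunE /=.
have lt_n := ltn_ord (val e).2.
have [ij|[i0 jn]] := cycle_edge n_ge3 e.
  rewrite -ij /=; have [i0|i0] := eqVneq ((val e).1 : nat) 0%N.
    by rewrite i0 /=; case: a; case: b.
  have [i1|i1] := eqVneq ((val e).1 : nat) 1%N.
    by rewrite i1 /=; case: a; case: b.
  rewrite eqSS (negPf i0).
  by case: a; case: b.
rewrite i0 /=.
have -> : ((val e).2 == 0 :> nat) = false by apply/negbTE/eqP; lia.
have -> : ((val e).2 == 1 :> nat) = false by apply/negbTE/eqP; lia.
by case: a; case: b.
Qed.

(** This is the generator of the ideal of the triangle, lifted to the cycle. *)
Definition quartic := word_binomial K (parity_word true) (parity_word false).

Lemma quartic_ideal : graph_ideal K G quartic.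
Proof.
rewrite /graph_ideal /= rmorphB /= -!(table_monomial_cyc K n_ge3).
rewrite (same_fiber_image K n_ge3 (v := fun r => cyc n_ge3 (parity_state false r))).
  by rewrite subrr.
by apply: table_fiber => e a b; exact: parity_word_pairs.
Qed.

Definition parity_exp p : 'X_{1..#|state n|} :=
  (\sum_(x <- parity_word p) U_(enum_rank x))%MM.

Lemma parity_word_monomial p : word_monomial K (parity_word p) = 'X_[parity_exp p].
Proof. by rewrite /word_monomial mprodXE. Qed.

Lemma parity_expE p x : parity_exp p (enum_rank x) = (x \in parity_word p).
Proof.
rewrite mnm_sumE -(count_uniq_mem x) /parity_word; last first.
  by rewrite map_inj_uniq ?enum_uniq //; exact: parity_state_inj.
rewrite -sum1_count [RHS]big_mkcond; apply: eq_bigr => y _ /=.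
by rewrite mnm1E (inj_eq enum_rank_inj); case: eqP.
Qed.

Lemma flat_tail_parity_word p a b c :
  (flat_tail a b c \in parity_word p) = (c == p (+) a (+) b).
Proof.
apply/mapP/eqP => [[[a' b'] _ /flat_tail_inj [-> -> ->]] //|->].
by exists (a, b); rewrite ?mem_enum.
Qed.

Definition flat_supported m :=
  forall x, m (enum_rank x) != 0 -> x = flat_tail (x v0) (x v1) (x v2).

Lemma sum_flat m (F : state n -> nat) : flat_supported m ->
  (\sum_x m (enum_rank x) * F x =
   \sum_(a : bool) \sum_(b : bool) \sum_(c : bool)
     m (enum_rank (flat_tail a b c)) * F (flat_tail a b c))%N.
Proof.
move=> flat.
rewrite (partition_big (fun x => ((x v0, x v1), x v2)) xpredT) //=.
rewrite [RHS](pair_bigA _ (fun a b => \sum_c _)) /=.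
rewrite [RHS](pair_bigA _ (fun ab c => (m (enum_rank (flat_tail ab.1 ab.2 c)) *
  F (flat_tail ab.1 ab.2 c))%N)) /=.
apply: eq_bigr => -[[a b] c] _ /=.
rewrite (bigD1 (flat_tail a b c)) /=; last by rewrite !ffunE /=.
rewrite big1 ?addn0 // => x /andP [/eqP [xa xb xc] ne].
have [->|/flat e] := eqVneq (m (enum_rank x)) 0%N; first by rewrite mul0n.
by rewrite e xa xb xc eqxx in ne.
Qed.

(** Let [m'] be a partner of [m] in the support of [g].  Every word of [m] has a
    constant tail; the vanishing of the marginals 0,1 and 1,0 on the edges of the
    tail forces the same for [m'].  So [m] and [m'] are 2 x 2 x 2 tables with the
    same edge marginals, and they differ by a multiple of the parity function.
    As [m] vanishes on one parity class and [m'] is nonnegative, [m] is positive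
    on the whole other class, so its degree is at least 4. *)
Lemma low_degree_coeff (g : {mpoly K[#|state n|]}) m :
  graph_ideal K G g -> (m <= parity_exp true)%MM -> (mdeg m <= 3)%N -> g@_m = 0.
Proof.
move=> Ig le_m deg_m; apply: memN_msupp_eq0; apply/negP => mg.
have [m' [_ /negP ne e]] := support_partner Ig mg.
have m_le x : (m (enum_rank x) <= (x \in parity_word true))%N.
  by rewrite -parity_expE; exact: (mnm_lepP le_m).
have m_word x : m (enum_rank x) != 0%N -> x \in parity_word true.
  by move=> mx; have := m_le x; case: (x \in _) => //; case: (m _) mx.
have m_flat : flat_supported m.
  by move=> x /m_word /mapP [ab _ ->]; rewrite !ffunE.
have edges (d : edge G) a b :
    (\sum_x m' (enum_rank x) * ((x (val d).1 == a) && (x (val d).2 == b)) =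
     \sum_x m (enum_rank x) * ((x (val d).1 == a) && (x (val d).2 == b)))%N.
  by rewrite -!monomial_exp_edge e.
have m'_flat : flat_supported m'.
  move=> x m'x.
  have step i (lt_i : (i.+1 < n)%N) : (2 <= i)%N ->
      x (Ordinal (ltnW lt_i)) = x (Ordinal lt_i).
    move=> i2; apply/eqP; apply: contraNT m'x => nx.
    have := edges (edge_succ lt_i) (x (Ordinal (ltnW lt_i))) (x (Ordinal lt_i)).
    rewrite [in RHS]big1 => [/eqP|y _]; last first.
      have [->|/m_flat ey] := eqVneq (m (enum_rank y)) 0%N; first by rewrite mul0n.
      have -> : y (Ordinal (ltnW lt_i)) = y (Ordinal lt_i).
        by rewrite ey !ffunE /=; case: i lt_i i2 {nx} => [|[|i]].
      apply/eqP; rewrite muln_eq0; apply/orP; right.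
      by move: nx; case: (x _); case: (x _); case: (y _).
    by rewrite sum_nat_eq0 => /forallP /(_ x) /=; rewrite !eqxx muln1.
  have tail i (lt_i : (i < n)%N) : (2 <= i)%N -> x (Ordinal lt_i) = x v2.
    elim: i lt_i => // i IH lt_i; rewrite leq_eqVlt => /predU1P [i2|i2].
      by congr (x _); apply: val_inj; rewrite /= -i2.
    by rewrite -step // IH.
  apply/ffunP => -[i lt_i]; rewrite ffunE /=.
  case: i lt_i => [|[|i]] lt_i /=; last exact: tail.
    by congr (x _); apply: val_inj.
  by congr (x _); apply: val_inj.
have triangle (d : edge G) a b : (\sum_(a' : bool) \sum_(b' : bool) \sum_(c' : bool)
     m' (enum_rank (flat_tail a' b' c')) *
       ((flat_tail a' b' c' (val d).1 == a) && (flat_tail a' b' c' (val d).2 == b)) =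
   \sum_(a' : bool) \sum_(b' : bool) \sum_(c' : bool)
     m (enum_rank (flat_tail a' b' c')) *
       ((flat_tail a' b' c' (val d).1 == a) && (flat_tail a' b' c' (val d).2 == b)))%N.
  rewrite -(sum_flat (fun x => (x _ == a) && (x _ == b) : nat) m'_flat).
  by rewrite -(sum_flat (fun x => (x _ == a) && (x _ == b) : nat) m_flat).
pose M a b c := m (enum_rank (flat_tail a b c)).
pose M' a b c := m' (enum_rank (flat_tail a b c)).
have last_not i : (i < 2)%N -> (n.-1 == i) = false by move=> ?; apply/negbTE/eqP; lia.
have E01 a b : (M' a b false + M' a b true = M a b false + M a b true)%N.
  have := triangle (edge_succ (ltnW n_ge3)) a b; rewrite /M /M'.
  by rewrite !big_bool !ffunE /=; case: a; case: b; rewrite /= ?muln0 ?muln1; lia.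
have E12 b c : (M' false b c + M' true b c = M false b c + M true b c)%N.
  have := triangle (edge_succ n_ge3) b c; rewrite /M /M'.
  by rewrite !big_bool !ffunE /=; case: b; case: c; rewrite /= ?muln0 ?muln1; lia.
have E02 a c : (M' a false c + M' a true c = M a false c + M a true c)%N.
  have := triangle (edge_last n_ge3) a c; rewrite /M /M'.
  rewrite !big_bool !ffunE /= !last_not //.
  by case: a; case: c; rewrite /= ?muln0 ?muln1; lia.
have bound a b c : (M a b c <= (c == ~~ (a (+) b)))%N.
  by have := m_le (flat_tail a b c); rewrite flat_tail_parity_word -addbA.
have total : (\sum_(a : bool) \sum_(b : bool) \sum_(c : bool) M a b c <= 3)%N.
  apply: leq_trans deg_m; rewrite mdegE (reindex (@enum_rank (state n))) /=; last first.
    by apply: onW_bij; exact: enum_rank_bij.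
  rewrite [leqRHS](eq_bigr (fun x => m (enum_rank x) * 1)%N) => [|x _]; last by rewrite muln1.
  rewrite (sum_flat (fun=> 1%N) m_flat) eq_leq //.
  by do 3![apply: eq_bigr => ? _]; rewrite muln1.
have eqM a b c : M' a b c = M a b c.
  have := (bound false false false, bound false false true, bound false true false,
    bound false true true, bound true false false, bound true false true,
    bound true true false, bound true true true).
  move: total; rewrite !big_bool.
  have := (E01 false false, E01 false true, E01 true false, E01 true true).
  have := (E12 false false, E12 false true, E12 true false, E12 true true).
  have := (E02 false false, E02 false true, E02 true false, E02 true true).
  clear; move=> /=.
  case=> [[[? ?] ?] ?] [[[? ?] ?] ?] [[[? ?] ?] ?] ? [[[[[[[? ?] ?] ?] ?] ?] ?] ?].
  by case: a; case: b; case: c; lia.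
apply: ne; apply/eqP/mnmP => i; rewrite -(enum_valK i).
set x := enum_val i.
have [z|/m_flat ->] := eqVneq (m (enum_rank x)) 0%N; last exact: eqM.
have [->//|/m'_flat ->] := eqVneq (m' (enum_rank x)) 0%N; last exact: eqM.
Qed.

(** The coefficient of the first monomial of the quartic vanishes on every
    multiple of an element of degree less than 4 of the ideal. *)
Lemma quartic_not_low_degree :
  ~ ideal_span [set f | graph_ideal K G f /\ (tdegree f < 4)%N] quartic.
Proof.
move=> [d [c [g [low eq]]]].
have : quartic@_(parity_exp true) = 1.
  rewrite /quartic /word_binomial mcoeffB !parity_word_monomial !mcoeffX eqxx.
  case: eqP => [e|_]; last by rewrite subr0.
  have := congr1 (fun k : 'X_{1..#|state n|} => k (enum_rank (flat_tail true true true))) e.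
  by rewrite !parity_expE !flat_tail_parity_word.
rewrite eq raddf_sum big1 => [/esym/eqP|i _]; first by rewrite oner_eq0.
have [Ig deg_g] := low i.
rewrite /= mcoeffM big1 // => -[[k1 ?] [k2 ?]] /= /eqP ek.
have le_k : (k2 <= parity_exp true)%MM.
  by apply/mnm_lepP => j; rewrite ek mnmDE leq_addl.
have [/(low_degree_coeff Ig le_k) ->|gt3] := leqP (mdeg k2) 3; first by rewrite mulr0.
rewrite (@memN_msupp_eq0 _ _ (g i)) ?mulr0 //.
apply: contraTN deg_g => /msize_mdeg_lt lt; rewrite -leqNgt /tdegree.
by apply: (leq_trans gt3); rewrite -ltnS prednK //; exact: leq_ltn_trans lt.
Qed.
End LowerBound.

(** * The Markov width of a cycle *)

Theorem theorem3p1 (R : realType) (n : nat) (hn : (3 <= n)%N) :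
  has_markov_width (graph_ideal (complex R) (cycle_graph n)) 4 /\
  ideal_span (homog_part (graph_ideal (complex R) (cycle_graph n)) 2 `|`
              homog_part (graph_ideal (complex R) (cycle_graph n)) 4)
  = graph_ideal (complex R) (cycle_graph n).
Proof.
have gen := cycle_ideal_generated (complex R) hn.
split.
  apply: (markov_width_intro gen) => [f /cycle_generators_homog [_ [h|h]]|low].
  - by exists 2%N.
  - by exists 4%N.
  - apply: (@quartic_not_low_degree (complex R) n hn); apply: low.
    exact: quartic_ideal.
apply/seteqP; split.
  rewrite [X in _ `<=` X]gen; apply: span_least => f [[If _]|[If _]]; by rewrite -gen.
rewrite [X in X `<=` _]gen; apply: span_mono => f /= /cycle_generators_homog [If [h|h]].
  by left.
by right.
Qed.
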